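(* Fix $n\in\mathbb Z_{\ge2}$ and $k\in\mathbb Z_{\ge1}$, and let $\searrow_n=n(n-1)\cdots1$. Let $\Pi:\mathbb R^{\mathcal C_{n-1}(k)}\to\mathbb R^{\mathrm{Av}_k(\searrow_n)}$ be the linear map sending the basis vector indexed by $(\pi,\mathfrak c)\in\mathcal C_{n-1}(k)$ to the basis vector indexed by $\pi$ (the map forgetting colourings). Then $$P^{\mathrm{Av}(\searrow_n)}_k=\Pi\big(P(\mathcal{O}v_c(k,\searrow_n))\big),$$ where $\mathbb R^{\mathrm{Av}_k(\searrow_n)}$ is identified with the subspace of $\mathbb R^{\mathcal S_k}$ of vectors vanishing outside $\mathrm{Av}_k(\searrow_n)$.
   Context: For $I=\{i_1<\dots<i_m\}$, $\mathrm{pat}_I(\sigma)$ is the unique permutation of $[m]$ with entries in the same relative order as $\sigma(i_1),\dots,\sigma(i_m)$. $\sigma$ avoids $\pi$ if no $I$ has $\mathrm{pat}_I(\sigma)=\pi$; $\mathrm{Av}_m(\searrow_n)$ is the set of size-$m$ permutations avoiding $\searrow_n$ (with $\mathrm{Av}_0$ consisting of the empty permutation), $\mathrm{Av}(\searrow_n)=\bigcup_{m\ge1}\mathrm{Av}_m(\searrow_n)$. $\widetilde{\mathrm{c\text{-}occ}}(\pi,\sigma)$ for $\pi\in\mathcal S_k,\sigma\in\mathcal S_m$ is $1/m$ times the number of intervals $I=\{i,\dots,i+k-1\}$ with $\mathrm{pat}_I(\sigma)=\pi$. $P^{\mathrm{Av}(B)}_k$ is the set of $\vec v\in[0,1]^{\mathcal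 S_k}$ for which there is a sequence $(\sigma^m)$ in $\mathrm{Av}(B)$ with $|\sigma^m|\to\infty$ and $\widetilde{\mathrm{c\text{-}occ}}(\pi,\sigma^m)\to\vec v_\pi$ for all $\pi\in\mathcal S_k$. Colourings: a colouring of $\sigma\in\mathcal S_m$ is a map $\mathfrak c:[m]\to\mathbb Z_{\ge1}$ on indices; the pair $(\sigma,\mathfrak c)$ is a coloured permutation. Restriction: for $I=\{i_1<\dots<i_j\}$, $\mathrm{pat}_I(\sigma,\mathfrak c)=(\mathrm{pat}_I(\sigma),\mathfrak c')$ with $\mathfrak c'(\ell)=\mathfrak c(i_\ell)$; $\mathrm{be}_j(\cdot)=\mathrm{pat}_{\{1,\dots,j\}}(\cdot)$ and $\mathrm{en}_j(\cdot)=\mathrm{pat}_{\{m-j+1,\dots,m\}}(\cdot)$. The RITMO colouring $\mathbb C(\sigma)$ is defined by processing indices in decreasing order of value, giving each index $i$ the smallest positive integer $c$ such that no already coloured index $j<i$ (necessarily with $\sigma(j)>\sigma(i)$) has colour $c$; equivalently, colour 1 is given to the left-to-right maxima, colour 2 to the left-to-right maxima of the remaining entries, etc. Write $\mathbb S(\sigma)=(\sigma,\mathbb C(\sigma))$. For $\sigma\in\mathrm{Av}(\searrow_n)$, $\mathbb C(\sigma)$ takes values in $[n-1]$. A coloured permutation $(\pi,\mathfrak c)$ with $\pi\in\mathrm{Av}_k(\searrow_n)$ is an inherited colouring if there is $\sigma\in\mathrm{Av}(\searrow_n)$ with $|\sigma|\ge k$ and $\mathrm{en}_k(\mathbb S(\sigma))=(\pi,\mathfrak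 c)$. $\mathcal C_{n-1}(k)$ is the set of inherited colourings $(\pi,\mathfrak c)$ with $\pi\in\mathrm{Av}_k(\searrow_n)$ (their colours lie in $[n-1]$). Coloured overlap graph $\mathcal{O}v_c(k,\searrow_n)$: vertex set $\mathcal C_{n-1}(k-1)$, edge set $\mathcal C_{n-1}(k)$, the edge $(\pi,\mathfrak c)$ going from $\mathrm{be}_{k-1}(\pi,\mathfrak c)$ to $\mathrm{en}_{k-1}(\pi,\mathfrak c)$. A simple cycle is a closed walk with distinct edges and distinct vertices; for a nonempty cycle $\mathcal C$, $\vec e_{\mathcal C}\in\mathbb R^E$ has $e$-coordinate (number of occurrences of $e$ in $\mathcal C$)$/|\mathcal C|$; the cycle polytope $P(G)$ is the convex hull of $\vec e_{\mathcal C}$ over simple cycles. *)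

(* Defs.v *)
From HB Require Import structures.
From mathcomp Require Import all_boot all_order all_algebra perm.
From mathcomp Require Import all_classical all_reals all_analysis.
Set Implicit Arguments. Unset Strict Implicit. Unset Printing Implicit Defensive.
Import Order.TTheory GRing.Theory Num.Theory.
Import numFieldNormedType.Exports.
Local Open Scope ring_scope.
Local Open Scope classical_set_scope.

(* Permutations of size m are encoded as sequences of nat that are
   permutations of [0, 1, ..., m-1] (0-based values). *)
Definition is_permseq (s : seq nat) : bool := perm_eq s (iota 0 (size s)).

Definition std (s : seq nat) : seq nat := [seq count (fun y => (y < x)%N) s | x <- s].

Definition decr (n : nat) : seq nat := rev (iota 0 n).

Definition avoids_decr (n : nat) (s : seq nat) : Prop :=
  forall t, subseq t s -> std t <> decr n.

Definition inAv (n : nat) (s : seq nat) : Prop :=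
  is_permseq s /\ (1 <= size s)%N /\ avoids_decr n s.

Definition inAvk (n k : nat) (s : seq nat) : Prop :=
  is_permseq s /\ size s = k /\ avoids_decr n s.

Definition perm_seq k (p : 'S_k) : seq nat := [seq nat_of_ord (p i) | i <- enum 'I_k].

Definition cocc (R : realType) k (p : 'S_k) (s : seq nat) : R :=
  (count (fun i => std (take k (drop i s)) == perm_seq p) (iota 0 (size s - k)%N.+1))%:R
  / (size s)%:R.

Definition PAv (R : realType) (n k : nat) (v : 'S_k -> R) : Prop :=
  exists sigma : nat -> seq nat,
    (forall j, inAv n (sigma j)) /\
    (forall M, exists N, forall j, (N <= j)%N -> (M <= size (sigma j))%N) /\
    (forall p : 'S_k, (fun j => cocc R p (sigma j)) @ \oo --> v p).

Arguments PAv R n k v : clear implicits.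

(* coloured permutation: (permutation, colour sequence), colours positive *)
Definition cperm := (seq nat * seq nat)%type.

Definition mexpos (u : seq nat) : nat :=
  (find (fun x => x.+1 \notin u) (iota 0 (size u).+1)).+1.

(* RITMO colouring: process values in decreasing order; colour 0 = not yet coloured.
   The index i holding value v gets the smallest positive colour not used by an
   already coloured index j < i. *)
Definition ritmo_step (s : seq nat) (c : seq nat) (v : nat) : seq nat :=
  let i := index v s in
  let used := [seq nth 0 c j | j <- iota 0 i & nth 0 c j != 0] in
  set_nth 0 c i (mexpos used).

Definition ritmo (s : seq nat) : seq nat :=
  foldl (ritmo_step s) (nseq (size s) 0) (rev (iota 0 (size s))).

Definition SS (s : seq nat) : cperm := (s, ritmo s).

Definition be (j : nat) (x : cperm) : cperm := (std (take j x.1), take j x.2).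
Definition en (j : nat) (x : cperm) : cperm :=
  (std (drop (size x.1 - j)%N x.1), drop (size x.2 - j)%N x.2).

Definition inherited (n k : nat) (x : cperm) : Prop :=
  inAvk n k x.1 /\
  exists sigma, inAv n sigma /\ (k <= size sigma)%N /\ en k (SS sigma) = x.

(* Coloured overlap graph Ov_c(k, decr n): vertices C_{n-1}(k-1), edges C_{n-1}(k),
   edge e goes from be_{k-1} e to en_{k-1} e.
   A simple cycle is a nonempty sequence of edges e_1 ... e_l with
   target(e_i) = source(e_{i+1}) cyclically, distinct edges and distinct vertices. *)
Definition simple_cycle (n k : nat) (C : seq cperm) : Prop :=
  C != [::] /\ (forall e, e \in C -> inherited n k e) /\
  cycle (fun e f => en k.-1 e == be k.-1 f) C /\
  uniq C /\ uniq [seq be k.-1 e | e <- C].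

Definition ecyc (R : realType) (C : seq cperm) (e : cperm) : R :=
  (count (pred1 e) C)%:R / (size C)%:R.

(* cycle polytope: convex hull of the e_C over simple cycles
   (vectors in R^E are represented by functions cperm -> R) *)
Definition cycle_polytope (R : realType) (n k : nat) (x : cperm -> R) : Prop :=
  exists l : seq (R * seq cperm),
    (forall q, q \in l -> 0 <= q.1 /\ simple_cycle n k q.2) /\
    \sum_(q <- l) q.1 = 1 /\
    (forall e, x e = \sum_(q <- l) q.1 * ecyc R q.2 e).

Fixpoint colourings (k n : nat) : seq (seq nat) :=
  if k is k'.+1 then [seq c :: t | c <- iota 1 n.-1, t <- colourings k' n] else [:: [::]].

Arguments cycle_polytope R n k x : clear implicits.

Definition Pi (R : realType) (n k : nat) (x : cperm -> R) (p : 'S_k) : R :=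
  \sum_(c <- colourings k n) x (perm_seq p, c).

Arguments Pi R n k x p : clear implicits.

Definition Pi_cycle_polytope (R : realType) (n k : nat) (v : 'S_k -> R) : Prop :=
  exists x : cperm -> R, cycle_polytope R n k x /\ forall p : 'S_k, v p = Pi R n k x p.

Arguments Pi_cycle_polytope R n k v : clear implicits.

(* Main.v *)
Require Import Defs.
From HB Require Import structures.
From mathcomp Require Import all_boot all_order all_algebra perm.
From mathcomp Require Import all_classical all_reals all_analysis.
From mathcomp Require Import zify ring lra.

(** The RITMO colour of an entry is the length of the longest decreasing
    subsequence ending there.  So it depends only on the entries to the left,
    avoiding [decr n] means using fewer than [n] colours, and the windows of a
    coloured permutation form a walk in the overlap graph.  Removing simple
    cycles from this walk leaves a rest of bounded size, hence the pattern
    frequencies are within O(1/size) of the projected polytope, which is closed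
    because it is the image of a compact simplex.
    Conversely, when all colours below [n] already occur in a permutation, a last
    entry can be inserted so as to follow any edge leaving its end vertex: the
    required height exists because an entry constraining it from above or below
    in the witness of the edge either lies in the window or is ruled out by the
    colours in the window.  Direct sums let one concatenate walks around several
    cycles, each repeated in proportion to its weight. *)

Set Implicit Arguments. Unset Strict Implicit. Unset Printing Implicit Defensive.

(** * Order isomorphism of sequences and standardisation *)

Definition oiso (s t : seq nat) : Prop :=
  size s = size t /\
  forall i j, i < size s -> j < size s ->
    (nth 0 s i < nth 0 s j) = (nth 0 t i < nth 0 t j).

Lemma oiso_refl s : oiso s s.
Proof. by []. Qed.

Lemma oiso_sym s t : oiso s t -> oiso t s.
Proof. by case=> es H; split=> // i j; rewrite -es => hi hj; rewrite H. Qed.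

Lemma oiso_trans s t u : oiso s t -> oiso t u -> oiso s u.
Proof.
case=> es H [et H']; split; first by rewrite es.
by move=> i j hi hj; rewrite H // H' -?es.
Qed.

Lemma oiso_take m s t : oiso s t -> oiso (take m s) (take m t).
Proof.
case=> es H; split; first by rewrite !size_take es.
move=> i j; rewrite size_take_min !leq_min => /andP[im it] /andP[jm jt].
by rewrite !nth_take // H.
Qed.

Lemma oiso_drop m s t : oiso s t -> oiso (drop m s) (drop m t).
Proof.
case=> es H; split; first by rewrite !size_drop es.
by move=> i j; rewrite size_drop => hi hj; rewrite !nth_drop H //; lia.
Qed.

Lemma oiso_map (f : nat -> nat) s :
  {in s &, {mono f : x y / x < y}} -> oiso (map f s) s.
Proof.
move=> fM; split; rewrite size_map // => i j hi hj.
by rewrite !(nth_map 0) // fM ?mem_nth.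
Qed.

Lemma size_std s : size (std s) = size s.
Proof. by rewrite size_map. Qed.

(** Counting positions instead of values expresses [std] through comparisons of entries only, which
    is what [oiso] transports. *)
Lemma std_iota s :
  std s = [seq count (fun j => nth 0 s j < nth 0 s i) (iota 0 (size s))
          | i <- iota 0 (size s)].
Proof.
have e : s = map (nth 0 s) (iota 0 (size s)) by rewrite -/(mkseq _ _) mkseq_nth.
rewrite /std {2}e -map_comp; apply: eq_map => i /=.
by rewrite {2}e count_map.
Qed.

Lemma std_eq_oiso s t : oiso s t -> std s = std t.
Proof.
case=> es H; rewrite !std_iota -es; apply/eq_in_map => i.
rewrite mem_iota /= => hi; apply: eq_in_count => j; rewrite mem_iota /= => hj.
by rewrite H.
Qed.

Lemma std_mono s : {in s &, {mono (fun x => count (fun y => y < x) s) : x y / x < y}}.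
Proof.
have W x y : x <= y -> count (fun z => z < x) s <= count (fun z => z < y) s.
  by move=> xy; apply: sub_count => z /= zx; apply: leq_trans xy.
move=> x y xs ys /=; case: (ltnP x y) => [xy|/W]; last by rewrite ltnNge => ->.
apply: (@leq_trans (count (predU (fun z => z < x) (pred1 x)) s)).
  rewrite -(addn0 (_.+1)) -[X in _ <= X]addn0.
  have := count_predUI (fun z => z < x) (pred1 x) s.
  rewrite (@eq_count _ (predI _ _) pred0); last first.
    by move=> z /=; apply/negP => /andP[zx /eqP e]; rewrite e ltnn in zx.
  rewrite count_pred0 => ->; have : 0 < count_mem x s by rewrite -has_count has_pred1.
  by move=> c0; rewrite addn0 -addn1 leq_add2l.
by apply: sub_count => z /=; case/orP => [zx|/eqP->//]; apply: ltn_trans xy.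
Qed.

Lemma oiso_std s : oiso (std s) s.
Proof. exact/oiso_map/std_mono. Qed.

Lemma oiso_eq_std s t : std s = std t -> oiso s t.
Proof.
by move=> e; apply: oiso_trans (oiso_std t); rewrite -e; apply/oiso_sym/oiso_std.
Qed.

Lemma std_take_std m s : std (take m (std s)) = std (take m s).
Proof. exact/std_eq_oiso/oiso_take/oiso_std. Qed.

Lemma std_drop_std m s : std (drop m (std s)) = std (drop m s).
Proof. exact/std_eq_oiso/oiso_drop/oiso_std. Qed.

Lemma oiso_uniq s t : oiso s t -> uniq s -> uniq t.
Proof.
case=> es H /(uniqP 0) us; apply/(uniqP 0) => i j; rewrite !inE -es => hi hj e.
apply: us => //; have := H i j hi hj; have := H j i hj hi.
by rewrite e ltnn; case: ltngtP.
Qed.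

Lemma permseq_uniq s : is_permseq s -> uniq s.
Proof. by move/perm_uniq ->; apply: iota_uniq. Qed.

Lemma mem_permseq s x : is_permseq s -> (x \in s) = (x < size s).
Proof. by move/perm_mem ->; rewrite mem_iota. Qed.

Lemma permseq_nth_lt s i : is_permseq s -> i < size s -> nth 0 s i < size s.
Proof. by move=> ps hi; rewrite -mem_permseq // mem_nth. Qed.

Lemma uniq_permseq s : uniq s -> (forall x, x \in s -> x < size s) -> is_permseq s.
Proof.
move=> us H; apply: uniq_perm => //; first exact: iota_uniq.
have [||_ //] := @uniq_min_size _ s (iota 0 (size s)) us; last by rewrite size_iota.
by move=> x /H; rewrite mem_iota.
Qed.

Lemma std_permseq s : uniq s -> is_permseq (std s).
Proof.
move=> us; apply: uniq_permseq; first exact: oiso_uniq (oiso_sym (oiso_std s)) us.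
move=> x /mapP[y ys ->]; rewrite size_std.
rewrite -(count_predC (fun z => z < y) s) -[ltnLHS]addn0 ltn_add2l -has_count.
by apply/hasP; exists y => //=; rewrite ltnn.
Qed.

Lemma count_ltn_iota x m : x <= m -> count (fun y => y < x) (iota 0 m) = x.
Proof.
move=> xm; rewrite -(subnKC xm) iotaD count_cat add0n.
rewrite (eq_in_count (a2 := predT)) ?count_predT ?size_iota; last first.
  by move=> y; rewrite mem_iota.
rewrite (eq_in_count (a2 := pred0)) ?count_pred0 ?addn0 // => y.
by rewrite mem_iota /= => /andP[xy _]; rewrite ltnNge xy.
Qed.

Lemma std_id s : is_permseq s -> std s = s.
Proof.
move=> ps; rewrite /std -[RHS]map_id; apply/eq_in_map => x xs /=.
rewrite (seq.permP ps) count_ltn_iota //.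
by apply/ltnW; rewrite -mem_permseq.
Qed.

(** * The decreasing permutation and the greedy form of the colouring *)

Lemma size_decr m : size (decr m) = m.
Proof. by rewrite size_rev size_iota. Qed.

Lemma nth_decr m i : i < m -> nth 0 (decr m) i = m - i.+1.
Proof.
move=> im; rewrite nth_rev size_iota // nth_iota //; lia.
Qed.

Lemma decr_permseq m : is_permseq (decr m).
Proof. by rewrite /is_permseq size_decr perm_rev. Qed.

(* Characterises [ritmo] without reference to the processing order by value. *)
Definition greedy (s c : seq nat) : Prop :=
  size c = size s /\
  forall i, i < size s ->
    [/\ 0 < nth 0 c i,
        forall j, j < i -> nth 0 s i < nth 0 s j -> nth 0 c j < nth 0 c i &
        forall d, 0 < d < nth 0 c i ->
          exists j, [/\ j < i, nth 0 s i < nth 0 s j & nth 0 c j = d]].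

(** Strong induction on the position: if the colours at [i] differ, the larger one is justified by
    an earlier larger entry carrying the smaller one. Both colourings agree there, against strict
    increase. *)
Lemma greedy_unique s c d : greedy s c -> greedy s d -> c = d.
Proof.
case=> sc Hc [sd Hd]; apply: (@eq_from_nth _ 0); first by rewrite sc.
move=> i; rewrite sc; elim/ltn_ind: i => i IH hi.
have [c0 cA cB] := Hc i hi; have [d0 dA dB] := Hd i hi.
case: (ltngtP (nth 0 c i) (nth 0 d i)) => // H.
- have [|j [ji sij e]] := dB (nth 0 c i); first by rewrite c0.
  by have := cA j ji sij; rewrite IH ?e ?ltnn //; apply: ltn_trans hi.
- have [|j [ji sij e]] := cB (nth 0 d i); first by rewrite d0.
  by have := dA j ji sij; rewrite -IH ?e ?ltnn //; apply: ltn_trans hi.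
Qed.

Lemma greedy_oiso s t c : oiso s t -> greedy s c -> greedy t c.
Proof.
case=> es H [sc Hc]; split; first by rewrite sc.
move=> i; rewrite -es => hi; have [c0 cA cB] := Hc i hi; split=> //.
  by move=> j ji; rewrite -H //; [apply: cA|apply: ltn_trans hi].
move=> d /cB[j [ji sij e]]; exists j; split=> //.
by rewrite -H //; apply: ltn_trans hi.
Qed.

Lemma greedy_take m s c : greedy s c -> greedy (take m s) (take m c).
Proof.
case=> sc Hc; split; first by rewrite !size_take sc.
move=> i; rewrite size_take_min leq_min => /andP[im it].
have [c0 cA cB] := Hc i it; rewrite !nth_take //; split=> //.
  by move=> j ji; rewrite !nth_take //; [apply: cA|apply: ltn_trans im|apply: ltn_trans im].
move=> d /cB[j [ji sij e]]; exists j; have jm := ltn_trans ji im.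
by rewrite !nth_take.
Qed.

Lemma mexposP (u : seq nat) :
  mexpos u \notin u /\ forall d, 0 < d < mexpos u -> d \in u.
Proof.
rewrite /mexpos; set a := fun x => x.+1 \notin u; set r := iota 0 _.
(* Pigeonhole: [(size u).+1] candidates cannot all lie in [u], so the search succeeds. *)
have hr : has a r.
  apply: contraT; rewrite -all_predC => /allP H.
  have : size (map S r) <= size u.
    apply: uniq_leq_size; first by rewrite map_inj_uniq ?iota_uniq //; apply: succn_inj.
    by move=> x /mapP[y /H /= /negPn hy ->].
  by rewrite size_map size_iota ltnn.
have hf : find a r < (size u).+1 by rewrite -[X in _ < X](size_iota 0) -has_find.
split; first by have := nth_find 0 hr; rewrite /a nth_iota.
case=> // d; rewrite ltnS => /andP[_ hd].
have := before_find 0 hd; rewrite /a nth_iota; last by apply: ltn_trans hf.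
by move/negbFE.
Qed.

(** Loop invariant of [ritmo] when exactly the values at least [v] have been processed. It asks only
    for distinct colours along decreasing pairs; strict increase is deduced at the end. *)
Definition ritmo_partial (s c : seq nat) (v : nat) : Prop :=
  size c = size s /\
  forall i, i < size s ->
    if nth 0 s i < v then nth 0 c i = 0 else
    [/\ 0 < nth 0 c i,
        forall j, j < i -> nth 0 s i < nth 0 s j -> nth 0 c j != nth 0 c i &
        forall d, 0 < d < nth 0 c i ->
          exists j, [/\ j < i, nth 0 s i < nth 0 s j & nth 0 c j = d]].

(** When [v] is processed, the coloured entries are those of larger value, so [u] lists the colours
    of the larger entries on the left. Entries coloured earlier only look at entries larger than
    themselves and are unaffected. *)
Lemma ritmo_partial_step s c v : is_permseq s -> v < size s ->
  ritmo_partial s c v.+1 -> ritmo_partial s (ritmo_step s c v) v.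
Proof.
move=> ps vs [sc Hc]; rewrite /ritmo_step.
set i0 := index v s; set u := [seq _ | _ <- _ & _].
have i0s : i0 < size s by rewrite index_mem mem_permseq.
have ni0 : nth 0 s i0 = v by rewrite nth_index ?mem_permseq.
have E i : i < size s -> (i == i0) = (nth 0 s i == v).
  by move=> hi; rewrite -ni0 nth_uniq ?permseq_uniq.
have [uN uB] := mexposP u.
split; first by rewrite size_set_nth sc; apply/maxn_idPr.
move=> i hi; have := Hc i hi; rewrite ltnS leq_eqVlt -E // nth_set_nth /=.
case: (eqVneq i i0) => [-> _|ii0 /=]; last first.
  case: ifP => // _ [c0 cA cB]; split=> //.
    move=> j ji sij; rewrite nth_set_nth /= ifN; first exact: cA.
    rewrite E; last by apply: ltn_trans hi.
    by apply/negP => /eqP e; have := Hc i hi; rewrite ltnS -e (ltnW sij); lia.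
  move=> d /cB[j [ji sij e]]; exists j; split=> //.
  rewrite nth_set_nth /= ifN //; rewrite E; last by apply: ltn_trans hi.
  by apply/negP => /eqP e'; have := Hc i hi; rewrite ltnS -e' (ltnW sij); lia.
rewrite ni0 ltnn; split=> //.
  move=> j ji sij; rewrite nth_set_nth /= ifN; last by rewrite neq_ltn ji.
  apply: contra uN => /eqP <-; apply/mapP; exists j => //.
  rewrite mem_filter mem_iota /= add0n ji andbT.
  have := Hc j (ltn_trans ji i0s); rewrite ltnS leqNgt sij /= => -[c0 _ _].
  by rewrite lt0n in c0.
move=> d /uB/mapP[j]; rewrite mem_filter mem_iota /= add0n => /andP[nz ji] ->.
exists j; split=> //; last by rewrite nth_set_nth /= ifN // neq_ltn ji.
rewrite ltnNge; apply/negP => le.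
by have := Hc j (ltn_trans ji i0s); rewrite ltnS le => e; rewrite e eqxx in nz.
Qed.

Lemma ritmo_greedy s : is_permseq s -> greedy s (ritmo s).
Proof.
move=> ps.
have H r v : v + r = size s ->
    ritmo_partial s (foldr (fun x z => ritmo_step s z x) (nseq (size s) 0) (iota v r)) v.
  elim: r v => [|r IH] v /=; last first.
    by move=> e; apply: ritmo_partial_step => //; [lia|apply: IH; lia].
  rewrite addn0 => ->; split; first by rewrite size_nseq.
  by move=> i hi; rewrite permseq_nth_lt // nth_nseq hi.
have := H (size s) 0 (add0n _); rewrite -foldl_rev -/(ritmo s) => -[sc Hc].
split=> // i hi; have := Hc i hi => -[c0 cA cB]; split=> //.
(* If [j] had a larger colour than [i], the colour of [i] would occur at an entry to the left of and
   above [j], hence also of [i], against distinctness. *)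
move=> j ji sij; rewrite ltnNge; apply/negP; rewrite leq_eqVlt => /orP[/eqP e|H'].
  by have := cA j ji sij; rewrite e eqxx.
have /= [_ _ jB] := Hc j (ltn_trans ji hi).
have [|l [lj sjl e]] := jB (nth 0 (ritmo s) i); first by rewrite c0.
by have := cA l (ltn_trans lj ji) (ltn_trans sij sjl); rewrite e eqxx.
Qed.

Lemma size_ritmo s : is_permseq s -> size (ritmo s) = size s.
Proof. by case/ritmo_greedy. Qed.

Lemma greedy_ritmo s c : is_permseq s -> greedy s c -> ritmo s = c.
Proof. by move=> ps; apply/greedy_unique/ritmo_greedy. Qed.

(** * Avoidance of a decreasing pattern in terms of colours *)

Lemma subseq_indices (s t : seq nat) : subseq t s ->
  exists l, [/\ sorted ltn l, forall i, i \in l -> i < size s & t = map (nth 0 s) l].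
Proof.
case/subseqP => m sm ->; exists (mask m (iota 0 (size s))); split.
- apply: (subseq_sorted ltn_trans (mask_subseq _ _)); exact: iota_ltn_sorted.
- by move=> i /mem_mask; rewrite mem_iota.
- by rewrite map_mask -/(mkseq _ _) mkseq_nth.
Qed.

Lemma sorted_gtn_std t : sorted gtn t -> std t = decr (size t).
Proof.
move=> st; rewrite -(std_id (decr_permseq _)); apply: std_eq_oiso; split.
  by rewrite size_decr.
have tr : transitive gtn by move=> x y z xy yz; apply: ltn_trans yz xy.
have H := sorted_ltn_nth tr 0 st.
move=> i j hi hj; rewrite !nth_decr //.
case: (ltngtP i j) => [ij|ji|->]; last by rewrite !ltnn.
  by have /= := H i j hi hj ij; lia.
by have /= := H j i hj hi ji; lia.
Qed.

(** Built backwards: an entry of colour above [d.+1] has a larger entry of colour [d.+1] on its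
    left, whose chain is extended by the current entry. *)
Lemma decreasing_chain s c d i : greedy s c -> i < size s -> d < nth 0 c i ->
  exists t, [/\ subseq t (take i.+1 s), size t = d.+1, sorted gtn t & last 0 t = nth 0 s i].
Proof.
move=> [sc Hc]; elim: d i => [|d IH] i hi di; rewrite (take_nth 0 hi).
  by exists [:: nth 0 s i]; rewrite sub1seq mem_rcons mem_head.
have [c0 cA cB] := Hc i hi.
have [|j [ji sij e]] := cB d.+1; first by [].
have [|t [ts szt st lt]] := IH j (ltn_trans ji hi); first by rewrite e.
exists (rcons t (nth 0 s i)); split.
- rewrite -!cats1; apply: cat_subseq => //.
  apply: subseq_trans ts _; rewrite -(take_takel s ji).
  exact: take_subseq.
- by rewrite size_rcons szt.
- case: t szt st lt {ts} => // x t _ /=.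
  by rewrite rcons_path => -> /= ->.
- by rewrite last_rcons.
Qed.

(** A colour at least [n] would end a decreasing chain of length [n]. Conversely colours increase
    strictly along a decreasing subsequence, so the last of [n] such entries has colour at least
    [n]. *)
Lemma avoids_decr_colours n s c : 0 < n -> greedy s c ->
  avoids_decr n s <-> (forall i, i < size s -> nth 0 c i < n).
Proof.
move=> n0 g; split=> [av i hi|H t /subseq_indices[l [sis iss ->]] e].
  rewrite ltnNge; apply/negP => ni.
  have [|t [ts st so _]] := @decreasing_chain s c n.-1 i g hi; first by lia.
  apply: (av t); last by rewrite sorted_gtn_std // st prednK.
  exact: subseq_trans ts (take_subseq _ _).
have [sz ord] : oiso (map (nth 0 s) l) (decr n).
  by apply: oiso_eq_std; rewrite e std_id // decr_permseq.
move: sz; rewrite size_map size_decr => sz.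
have [sc Hc] := g.
have L a : a < n -> nth 0 l a < size s by move=> an; rewrite iss ?mem_nth ?sz.
have K a : a < n -> a < nth 0 c (nth 0 l a).
  elim: a => [|a IH] ha.
    by have [] := Hc _ (L 0 ha).
  have ha' := ltnW ha.
  have [_ cA _] := Hc _ (L _ ha).
  apply: leq_ltn_trans (IH ha') (cA _ _ _); rewrite ?sz //.
    by apply: (sorted_ltn_nth ltn_trans 0 sis); rewrite ?inE ?sz.
  have := ord a.+1 a; rewrite size_map sz !(nth_map 0) ?sz // => -> //.
  by rewrite !nth_decr //; lia.
have pn : n.-1 < n by rewrite prednK.
by have := K _ pn; have := H _ (L _ pn); lia.
Qed.

Definition good (n : nat) (s : seq nat) : Prop := is_permseq s /\ avoids_decr n s.

Lemma goodP n s c : 0 < n -> is_permseq s -> greedy s c ->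
  (forall i, i < size s -> nth 0 c i < n) -> good n s.
Proof. by move=> n0 ps g H; split=> //; apply/(avoids_decr_colours n0 g). Qed.

Lemma good_colour n s i : 0 < n -> good n s -> i < size s ->
  0 < nth 0 (ritmo s) i < n.
Proof.
move=> n0 [ps av] hi; have g := ritmo_greedy ps.
have [_ /(_ i hi)[-> _ _]] := g.
by move/(avoids_decr_colours n0 g): av => /(_ i hi) ->.
Qed.

Lemma good_take n m s : 0 < n -> good n s -> good n (std (take m s)).
Proof.
move=> n0 gs; have [ps _] := gs.
have us : uniq (take m s) by apply/take_uniq/permseq_uniq.
apply: (@goodP _ _ (take m (ritmo s))) => //; first exact: std_permseq.
  apply: greedy_oiso (oiso_sym (oiso_std _)) _.
  exact/greedy_take/ritmo_greedy.
move=> i; rewrite size_std size_take_min leq_min => /andP[im hi].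
by rewrite nth_take //; case/andP: (good_colour n0 gs hi).
Qed.

Lemma ritmo_take m s : is_permseq s -> ritmo (std (take m s)) = take m (ritmo s).
Proof.
move=> ps; apply: greedy_ritmo; first by apply/std_permseq/take_uniq/permseq_uniq.
apply: greedy_oiso (oiso_sym (oiso_std _)) _.
exact/greedy_take/ritmo_greedy.
Qed.

(** * Direct sums *)

Definition dsum (s t : seq nat) : seq nat := s ++ map (addn (size s)) t.

Lemma size_dsum s t : size (dsum s t) = size s + size t.
Proof. by rewrite size_cat size_map. Qed.

Lemma dsum_permseq s t : is_permseq s -> is_permseq t -> is_permseq (dsum s t).
Proof.
rewrite /is_permseq size_dsum iotaD => ps pt; apply: perm_cat => //.
by rewrite add0n -[X in iota X _]addn0 iotaDl; apply: perm_map.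
Qed.

Lemma nth_dsum s t i : i < size s + size t -> nth 0 (dsum s t) i =
  if i < size s then nth 0 s i else size s + nth 0 t (i - size s).
Proof.
move=> hi; rewrite nth_cat; case: ltnP => // si.
by rewrite (nth_map 0) //; lia.
Qed.

(** The greedy conditions involve only larger entries on the left, and no entry of the first block
    is larger than one of the second. *)
Lemma greedy_dsum s t c d : is_permseq s -> greedy s c -> greedy t d ->
  greedy (dsum s t) (c ++ d).
Proof.
move=> ps [sc Hc] [sd Hd]; split; first by rewrite size_cat size_dsum sc sd.
move=> i; rewrite size_dsum => hi; rewrite nth_cat sc nth_dsum //.
case: (ltnP i (size s)) => si.
  have [c0 cA cB] := Hc i si; split=> //.
    move=> j ji; have js := ltn_trans ji si.
    have jst := ltn_trans ji hi.
    rewrite nth_dsum // js nth_cat sc js; exact: cA.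
  move=> e /cB[j [ji sij ej]]; exists j; have js := ltn_trans ji si.
  have jst := ltn_trans ji hi.
  by rewrite nth_dsum // js nth_cat sc js.
have hi' : i - size s < size t by lia.
have [c0 cA cB] := Hd _ hi'; split=> //.
  move=> j ji; have jst := ltn_trans ji hi.
  rewrite nth_dsum // nth_cat sc; case: (ltnP j (size s)) => js.
    by have := permseq_nth_lt ps js; lia.
  by rewrite ltn_add2l; apply: cA; lia.
move=> e /cB[j [ji sij ej]]; exists (size s + j).
have jt : size s + j < size s + size t by lia.
have js : (size s + j < size s) = false by lia.
rewrite nth_dsum // nth_cat sc js addKn ltn_add2l.
by split=> //; lia.
Qed.

Lemma ritmo_dsum s t : is_permseq s -> is_permseq t ->
  ritmo (dsum s t) = ritmo s ++ ritmo t.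
Proof.
move=> ps pt; apply: greedy_ritmo; first exact: dsum_permseq.
by apply: greedy_dsum => //; apply: ritmo_greedy.
Qed.

Lemma good_dsum n s t : 0 < n -> good n s -> good n t -> good n (dsum s t).
Proof.
move=> n0 gs gt; have [[ps _] [pt _]] := (gs, gt).
apply: (@goodP _ _ (ritmo s ++ ritmo t)) => //; first exact: dsum_permseq.
  by apply: greedy_dsum => //; apply: ritmo_greedy.
move=> i; rewrite size_dsum nth_cat size_ritmo // => hi; case: (ltnP i (size s)) => si.
  by case/andP: (good_colour n0 gs si).
have si' : i - size s < size t by lia.
by case/andP: (good_colour n0 gt si').
Qed.

Lemma ritmo_decr m : ritmo (decr m) = iota 1 m.
Proof.
apply: greedy_ritmo; first exact: decr_permseq.
split; rewrite size_decr ?size_iota // => i hi; rewrite nth_iota // nth_decr //.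
split=> //.
  move=> j ji; have jm := ltn_trans ji hi.
  by rewrite nth_iota // nth_decr //; lia.
move=> d /andP[d0 di]; exists d.-1; have dm : d.-1 < m by lia.
by rewrite nth_iota // nth_decr //; split; lia.
Qed.

Lemma good_decr n m : 0 < n -> m < n -> good n (decr m).
Proof.
move=> n0 mn; apply: (@goodP _ _ (iota 1 m)) => //; first exact: decr_permseq.
  by rewrite -ritmo_decr; apply/ritmo_greedy/decr_permseq.
by move=> i; rewrite size_decr => hi; rewrite nth_iota //; lia.
Qed.

(** * Insertion of a new last entry *)

Definition insert_last (h : nat) (s : seq nat) : seq nat := rcons (map (bump h) s) h.

Lemma ltn_bump h x y : (bump h x < bump h y) = (x < y).
Proof. by rewrite /bump; case: (leqP h x); case: (leqP h y); lia. Qed.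

Lemma size_insert_last h s : size (insert_last h s) = (size s).+1.
Proof. by rewrite size_rcons size_map. Qed.

Lemma insert_last_permseq h s : h <= size s -> is_permseq s ->
  is_permseq (insert_last h s).
Proof.
move=> hs ps; apply: uniq_permseq.
  rewrite rcons_uniq map_inj_uniq ?permseq_uniq // ?andbT; last first.
    move=> x y e; have := ltn_bump h x y; have := ltn_bump h y x.
    by rewrite e ltnn; case: ltngtP.
  by apply/mapP => -[x _]; rewrite /bump; case: (leqP h x); lia.
move=> x; rewrite size_insert_last mem_rcons inE => /orP[/eqP -> //|/mapP[y]].
by rewrite mem_permseq // => ys ->; rewrite /bump; case: (leqP h y); lia.
Qed.

Lemma nth_insert_last h s i : i <= size s -> nth 0 (insert_last h s) i =
  if i < size s then bump h (nth 0 s i) else h.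
Proof.
move=> hi; rewrite nth_rcons size_map; case: (ltnP i (size s)) => si; first by rewrite (nth_map 0).
by rewrite ifT //; apply/eqP; lia.
Qed.

Lemma ltn_insert_last h s i j : i < size s -> j < size s ->
  (nth 0 (insert_last h s) i < nth 0 (insert_last h s) j) = (nth 0 s i < nth 0 s j).
Proof.
move=> hi hj.
by rewrite (nth_insert_last h (ltnW hi)) (nth_insert_last h (ltnW hj)) hi hj ltn_bump.
Qed.

Lemma last_ltn_insert_last h s j : j < size s ->
  (nth 0 (insert_last h s) (size s) < nth 0 (insert_last h s) j) = (h <= nth 0 s j).
Proof.
move=> hj; rewrite (nth_insert_last h (ltnW hj)) (nth_insert_last h (leqnn _)) hj ltnn /bump.
by case: (leqP h (nth 0 s j)); lia.
Qed.

Lemma insert_last_ltn_last h s j : j < size s ->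
  (nth 0 (insert_last h s) j < nth 0 (insert_last h s) (size s)) = (nth 0 s j < h).
Proof.
move=> hj; rewrite (nth_insert_last h (ltnW hj)) (nth_insert_last h (leqnn _)) hj ltnn /bump.
by case: (leqP h (nth 0 s j)); lia.
Qed.

Lemma greedy_insert_last h s c g : greedy s c -> 0 < g ->
  (forall z, z < size s -> h <= nth 0 s z -> nth 0 c z < g) ->
  (forall d, 0 < d < g -> exists z, [/\ z < size s, h <= nth 0 s z & nth 0 c z = d]) ->
  greedy (insert_last h s) (rcons c g).
Proof.
move=> [sc Hc] g0 gA gB; split; first by rewrite size_rcons size_insert_last sc.
move=> i; rewrite size_insert_last ltnS leq_eqVlt => /orP[/eqP ->|hi].
  rewrite nth_rcons sc ltnn eqxx; split=> // [j js|d /gB[j [js sj ej]]].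
    by rewrite last_ltn_insert_last // nth_rcons sc js; apply: gA.
  by exists j; rewrite last_ltn_insert_last // nth_rcons sc js.
have [c0 cA cB] := Hc i hi; rewrite nth_rcons sc hi; split=> // [j ji|d /cB[j [ji sij ej]]].
  have js := ltn_trans ji hi.
  by rewrite ltn_insert_last // nth_rcons sc js; apply: cA.
have js := ltn_trans ji hi.
by exists j; rewrite ltn_insert_last // nth_rcons sc js.
Qed.

(** The last entry [y] of [t] is imitated at the end of [s], the [k] entries before it agreeing in
    order and colour with the last [k] of [s]. The height [h] is the lowest one meeting all lower
    bounds; it remains to see that no upper bound is violated and that every smaller colour occurs
    above it. *)
Lemma insertion_height s c t d o o' k :
  greedy s c -> greedy t d -> uniq s -> uniq t ->
  size s = o + k -> size t = o' + k.+1 ->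
  (forall a b, a < k -> b < k ->
    (nth 0 s (o + a) < nth 0 s (o + b)) = (nth 0 t (o' + a) < nth 0 t (o' + b))) ->
  (forall a, a < k -> nth 0 c (o + a) = nth 0 d (o' + a)) ->
  (forall e, 0 < e < nth 0 d (o' + k) -> exists2 z, z < size s & nth 0 c z = e) ->
  exists h,
    [/\ h = 0 \/ (exists2 x, x < size s & h = (nth 0 s x).+1),
        forall a, a < k -> (h <= nth 0 s (o + a)) = (nth 0 t (o' + k) < nth 0 t (o' + a)),
        forall z, z < size s -> h <= nth 0 s z -> nth 0 c z < nth 0 d (o' + k) &
        forall e, 0 < e < nth 0 d (o' + k) ->
          exists z, [/\ z < size s, h <= nth 0 s z & nth 0 c z = e]].
Proof.
move=> [sc Hc] [sd Hd] us ut ss st ord col full.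
set g := nth 0 d (o' + k); set y := nth 0 t (o' + k).
have [g0 gA gB] : [/\ 0 < g,
    forall j, j < o' + k -> y < nth 0 t j -> nth 0 d j < g &
    forall e, 0 < e < g -> exists j, [/\ j < o' + k, y < nth 0 t j & nth 0 d j = e]].
  by apply: Hd; rewrite st; lia.
(* Entries forced below the new one: those of colour at least [g], since colours must increase
   towards it from larger entries, and the window entries whose counterpart in [t] is below [y]. *)
pose low i := (g <= nth 0 c i) || ((o <= i) && (nth 0 t (o' + (i - o)) < y)).
pose h := \max_(i < size s | low i) (nth 0 s i).+1.
have hmax i : i < size s -> low i -> nth 0 s i < h.
  move=> hi li; rewrite /h.
  exact: (@leq_bigmax_cond _ (fun i : 'I_(size s) => low i)
           (fun i : 'I_(size s) => (nth 0 s i).+1) (Ordinal hi)).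
have hP : h = 0 \/ exists i, [/\ i < size s, low i & h = (nth 0 s i).+1].
  rewrite /h; elim/big_ind: _ => [|x z Hx Hz|i li]; first by left.
    by case: (leqP x z) => _.
  by right; exists i; rewrite ltn_ord.
exists h; split.
- by case: hP => [->|[i [hi _ ->]]]; [left|right; exists i].
- move=> a ak; case: (ltngtP y (nth 0 t (o' + a))) => [ya|ay|e].
  + case: hP => [->//|[i [hi /orP li ->]]].
    have da : nth 0 d (o' + a) < g by apply: gA => //; lia.
    case: li => [gi|/andP[oi iy]]; last first.
      have e : i = o + (i - o) by lia.
      by rewrite e ord; lia.
    (* Here [i] has colour at least [g] and the window entry at [o + a] has colour below [g]; [i]
       cannot exceed it. If [i] is to the left, colours would have to increase; if to the right, [i]
       is in the window and its counterpart, being above [y], has colour below [g]. *)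
    case: (ltngtP (nth 0 s i) (nth 0 s (o + a))) => // [ai|e]; last first.
      have oa : o + a < size s by lia.
      move/eqP: e; rewrite nth_uniq // => /eqP e.
      by move: gi; rewrite e col //; lia.
    have [_ cA _] := Hc (o + a) (ltac:(lia)).
    have [_ cA' _] := Hc i hi.
    case: (ltngtP i (o + a)) => [l|l|e].
    * by have := cA i l ai; rewrite col //; lia.
    * have e : i = o + (i - o) by lia.
      have bk : i - o < k by lia.
      move: ai gi; rewrite e ord // col // => ai gi.
      by have := gA (o' + (i - o)) (ltac:(lia)) (ltn_trans ya ai); lia.
    * by move: ai; rewrite e ltnn.
  + apply/negbTE; rewrite -ltnNge; apply: hmax; first by lia.
    by rewrite /low leq_addr addKn ay orbT.
  + move/eqP: e; rewrite nth_uniq // ?st; try lia.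
- move=> z hz; rewrite leqNgt => hs; rewrite ltnNge; apply: contra hs => gz.
  by rewrite hmax // /low gz.
- move=> e /andP[e0 eg].
  (* Colour [g.-1] suffices: an entry with this colour has larger entries of every smaller colour
     before it. *)
  suff [z [hz sz cz]] : exists z, [/\ z < size s, h <= nth 0 s z & nth 0 c z = g.-1].
    case: (ltngtP e g.-1) => [l|l|->]; [|lia|by exists z].
    have [_ _ cB] := Hc z hz.
    have [|j [jz sj ej]] := cB e; first by rewrite cz e0.
    by exists j; split => //; [apply: ltn_trans hz|apply: leq_trans sz (ltnW sj)].
  have gg : 0 < g.-1 < g by lia.
  (* If [h = 0], any entry of colour [g.-1] will do. If the maximising entry [i] has colour at least
     [g], a larger entry before it has colour [g.-1]. Otherwise [i] is a window entry below [y] of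
     colour less than [g]; the entry of [t] above [y] with colour [g.-1] cannot precede its
     counterpart, so it lies in the window and transfers to [s]. *)
  case: hP => [->|[i [hi /orP li ->]]].
    by have [z] := full _ gg; exists z.
  case: (leqP g (nth 0 c i)) => [gi|ig].
    have [_ _ cB] := Hc i hi.
    have [|j [ji sj ej]] := cB g.-1; first by lia.
    by exists j; split=> //; apply: ltn_trans hi.
  case: li => [|/andP[oi iy]]; first by lia.
  have [j [jk yj ej]] := gB _ gg.
  have e' : i = o + (i - o) by lia.
  have bk : i - o < k by lia.
  have [_ dA _] := Hd (o' + (i - o)) (ltac:(lia)).
  case: (ltngtP j (o' + (i - o))) => [l|l|E].
  + have := dA j l (ltn_trans iy yj); rewrite ej -col // -e'; lia.
  + have E : j = o' + (j - o') by lia.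
    exists (o + (j - o')); rewrite e' ord ?col -?E; try lia.
    by split=> //; [lia|apply: ltn_trans iy yj].
  + by move: yj; rewrite E; lia.
Qed.

(** * Extending a permutation along an edge of the overlap graph *)

(** With every colour below [n] present, the next entry can be given whichever colour an edge
    prescribes. *)
Definition full (n : nat) (s : seq nat) : Prop := forall d, 0 < d < n -> d \in ritmo s.

Definition ends_with (n k : nat) (e : cperm) (s : seq nat) : Prop :=
  [/\ good n s, full n s, k <= size s & en k (SS s) = e].

Definition overlap (k : nat) : rel cperm := fun e f => en k.-1 e == be k.-1 f.

Lemma inAv_good n s : inAv n s -> good n s.
Proof. by case=> ps [_ av]. Qed.

(** A witness that [f] is inherited shows the entry to imitate; the overlap condition matches the
    [k.-1] entries before it with the end of [s], so [insertion_height] applies. *)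
Lemma ends_with_step n k e f s : 1 < n -> 0 < k -> inherited n k f ->
  overlap k e f -> ends_with n k e s ->
  exists2 h, h <= size s & ends_with n k f (insert_last h s).
Proof.
case: k => // k n1 _ [_ [t [/inAv_good gt [kt ft]]]] /eqP ef [gs fs ks es].
have n0 : 0 < n by apply: ltnW.
have [[ps _] [pt _]] := (gs, gt).
have [gr gr'] := (ritmo_greedy ps, ritmo_greedy pt).
have [szc szd] := (size_ritmo ps, size_ritmo pt).
pose o := size s - k; pose o' := size t - k.+1.
have so : size s = o + k by lia.
have st : size t = o' + k.+1 by lia.
move: ef; rewrite -es -ft /en /be /SS /= !size_std !size_drop szc szd !std_drop_std.
rewrite !std_take_std !drop_drop.
rewrite (_ : size s - (size s - k.+1) - k + (size s - k.+1) = o); last by rewrite /o; lia.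
rewrite -/o' => -[/oiso_eq_std [_ ord] ecol].
have ord' a b : a < k -> b < k -> (nth 0 s (o + a) < nth 0 s (o + b))
    = (nth 0 t (o' + a) < nth 0 t (o' + b)).
  move=> ak bk; have := ord a b; rewrite size_drop so addKn => /(_ ak bk).
  by rewrite !nth_drop !nth_take // !nth_drop.
have col a : a < k -> nth 0 (ritmo s) (o + a) = nth 0 (ritmo t) (o' + a).
  by move=> ak; rewrite -!nth_drop ecol nth_take // nth_drop.
have ot : o' + k < size t by lia.
have /andP[g0 gn] := good_colour n0 gt ot.
have [||e0 he0|h [hh hord hA hB]] := insertion_height gr gr' _ _ so st ord' col.
- exact: permseq_uniq.
- exact: permseq_uniq.
- have /nthP : e0 \in ritmo s by apply: fs; lia.
  by move/(_ 0) => [z]; rewrite szc; exists z.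
have hs : h <= size s.
  by case: hh => [->//|[x xs ->]]; apply: permseq_nth_lt.
have pi := insert_last_permseq hs ps.
have gi := greedy_insert_last gr g0 hA hB.
have ri := greedy_ritmo pi gi.
exists h => //; split.
- apply: (goodP n0 pi gi) => i; rewrite size_insert_last ltnS leq_eqVlt nth_rcons szc.
  case: eqP => [-> _|_ /= hi]; first by rewrite ltnn.
  by rewrite hi; case/andP: (good_colour n0 gs hi).
- by move=> d dn; rewrite ri mem_rcons inE fs // orbT.
- by rewrite size_insert_last ltnW.
- rewrite /en /SS /= ri size_rcons szc size_insert_last subSS -/o.
  congr (_, _).
    apply: std_eq_oiso; split; first by rewrite !size_drop size_insert_last; lia.
    move=> a b; rewrite size_drop size_insert_last !nth_drop => ha hb.
    have [ak|ak] := ltnP a k; have [bk|bk] := ltnP b k.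
    + by rewrite ltn_insert_last; [rewrite ord'| lia | lia].
    + have -> : b = k by lia.
      rewrite -so insert_last_ltn_last; last by lia.
      rewrite ltnNge hord // -leqNgt leq_eqVlt.
      case: eqP => [E|//]; suff E' : o' + a = o' + k by lia.
      by have /(uniqP 0) := permseq_uniq pt; apply; rewrite ?inE // st; lia.
    + have -> : a = k by lia.
      by rewrite -so last_ltn_insert_last ?hord //; lia.
    + have -> : a = k by lia.
      have -> : b = k by lia.
      by rewrite !ltnn.
  rewrite drop_rcons ?szc; last by lia.
  rewrite ecol -[in RHS](cat_take_drop k (drop o' (ritmo t))) -cats1; congr (_ ++ _).
  by rewrite drop_drop [k + o']addnC (drop_nth 0) ?szd // drop_oversize // szd; lia.
Qed.

(** * Counting consecutive occurrences *)

(** The range is empty when [k] exceeds the size, whereas [cocc] always keeps at least one index;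
    [occ_cocc] reconciles the two. *)
Definition occ (k : nat) (p s : seq nat) : nat :=
  count (fun i => std (take k (drop i s)) == p) (iota 0 ((size s).+1 - k)).

Lemma occ_prefix k p s s' : size s <= size s' -> oiso (take (size s) s') s ->
  occ k p s' = occ k p s +
    count (fun i => std (take k (drop i s')) == p)
      (iota ((size s).+1 - k) (((size s').+1 - k) - ((size s).+1 - k))).
Proof.
move=> ss' os; rewrite {1}/occ.
rewrite -{1}(@subnKC ((size s).+1 - k) ((size s').+1 - k)); last by lia.
rewrite iotaD count_cat add0n; congr (_ + _).
apply: eq_in_count => i; rewrite mem_iota add0n /= => hi; congr (_ == _).
rewrite take_drop -(@take_takel _ (k + i) (size s)); last by lia.
by rewrite -take_drop; apply/std_eq_oiso/oiso_take/oiso_drop.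
Qed.

Lemma occ_prefix_bounds k p s s' : size s <= size s' -> oiso (take (size s) s') s ->
  occ k p s <= occ k p s' <= occ k p s + (size s' - size s).
Proof.
move=> ss' os; rewrite (occ_prefix k p ss' os) leq_addr leq_add2l.
by apply: leq_trans (count_size _ _) _; rewrite size_iota; lia.
Qed.

Lemma oiso_take_insert_last h s : oiso (take (size s) (insert_last h s)) s.
Proof.
rewrite /insert_last -cats1 take_cat size_map ltnn subnn take0 cats0.
by apply: oiso_map => x y _ _; apply: ltn_bump.
Qed.

Lemma occ_insert_last k p h s : 0 < k -> k <= size s ->
  occ k p (insert_last h s) =
  occ k p s + (std (drop ((size s).+1 - k) (insert_last h s)) == p).
Proof.
move=> k0 ks; rewrite (occ_prefix k p _ (oiso_take_insert_last h s)); last first.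
  by rewrite size_insert_last.
rewrite size_insert_last (_ : (size s).+2 - k - _ = 1) /=; last by lia.
by rewrite addn0 take_oversize // size_drop size_insert_last; lia.
Qed.

(** * Realising walks and repeated cycles *)

Definition pcount (p : seq nat) (w : seq cperm) : nat := count (fun f => f.1 == p) w.

Lemma ends_with_walk n k e w s : 1 < n -> 0 < k ->
  (forall f, f \in w -> inherited n k f) -> path (overlap k) e w ->
  ends_with n k e s ->
  exists s', [/\ ends_with n k (last e w) s', size s' = size s + size w &
    forall p, occ k p s' = occ k p s + pcount p w].
Proof.
move=> n1 k0; elim: w e s => [|f w IH] e s inh /=.
  by move=> _ es; exists s; split=> // [|p]; rewrite addn0.
case/andP => ef pw es.
have [h hs es'] := ends_with_step n1 k0 (inh f (mem_head _ _)) ef es.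
have [|s' [es'' ss' os']] := IH f (insert_last h s) _ pw es'.
  by move=> f' f'w; apply: inh; rewrite inE f'w orbT.
exists s'; split=> //; first by rewrite ss' size_insert_last addSnnS.
move=> p; rewrite os' occ_insert_last // -?addnA; last by case: es.
case: es' => _ _ _ <-; by rewrite /en /SS /= size_insert_last.
Qed.

Lemma ends_with_cycle n k C s r : 1 < n -> 0 < k -> simple_cycle n k C ->
  ends_with n k (last (head ([::], [::]) C) C) s ->
  exists s', [/\ ends_with n k (last (head ([::], [::]) C) C) s',
    size s' = size s + r * size C &
    forall p, occ k p s' = occ k p s + r * pcount p C].
Proof.
move=> n1 k0 [C0 [inh [cyc _]]]; elim: r s => [|r IH] s es.
  by exists s; split=> // *; rewrite mul0n addn0.
have [s1 [es1 ss1 os1]] := IH s es.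
(* As [C] is closed, its first edge may follow its last one, so the whole cycle can be walked again
   after its own last edge. *)
have pC : path (overlap k) (last (head ([::], [::]) C) C) C.
  by case: C C0 cyc {inh IH es es1 ss1 os1} => // x C _; rewrite /= rcons_path andbC.
have [s2 [es2 ss2 os2]] := ends_with_walk n1 k0 inh pC es1.
have E : last (last (head ([::], [::]) C) C) C = last (head ([::], [::]) C) C.
  by case: C C0 {IH es es1 ss1 os1 es2 ss2 os2 pC inh cyc}.
exists s2; split; first by rewrite -[X in ends_with _ _ X]E.
- by rewrite ss2 ss1 mulSnr addnA.
- by move=> p; rewrite os2 os1 mulSnr addnA.
Qed.

(* Prepending all the colours keeps every later insertion possible. *)
Lemma ends_with_start n k e : 1 < n -> inherited n k e ->
  exists B, forall s, good n s ->
    exists s', [/\ ends_with n k e s', size s' = size s + B &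
      forall p, occ k p s <= occ k p s' <= occ k p s + B].
Proof.
move=> n1 [_ [t [/inAv_good gt [kt et]]]].
have n0 : 0 < n by apply: ltnW.
exists (n.-1 + size t) => s gs.
have gd : good n (decr n.-1) by apply: good_decr => //; lia.
have gsd := good_dsum n0 gs gd.
have [[[[ps _] [pt _]] [pd _]] [psd _]] := (gs, gt, gd, gsd).
have gg := good_dsum n0 gsd gt.
have sz : size (dsum (dsum s (decr n.-1)) t) = size s + (n.-1 + size t).
  by rewrite !size_dsum size_decr addnA.
exists (dsum (dsum s (decr n.-1)) t); split=> //.
  split=> //.
  - move=> d /andP[d0 dn]; rewrite ritmo_dsum // ritmo_dsum // ritmo_decr.
    by rewrite !mem_cat mem_iota d0 /= (_ : d < 1 + n.-1) ?orbT //; lia.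
  - by rewrite sz; lia.
  - rewrite -et /en /SS /= ritmo_dsum // size_cat !size_ritmo // size_dsum.
    rewrite drop_cat size_ritmo // ltnNge (_ : _ <= _) /=; last by lia.
    rewrite /dsum drop_cat -/(dsum _ _) ltnNge (_ : _ <= _) /=; last by lia.
    rewrite (_ : _ + size t - k - _ = size t - k); last by lia.
    congr (_, _); rewrite -map_drop; apply/std_eq_oiso/oiso_map => x y _ _.
    by rewrite ltn_add2l.
move=> p; rewrite -[X in _ <= _ <= _ + X](addKn (size s)) -sz.
apply: occ_prefix_bounds; first by rewrite sz leq_addr.
rewrite /dsum -catA take_size_cat //; exact: oiso_refl.
Qed.

(** The constant [B] is fixed before the multiplicities: passing to another cycle costs a bounded
    number of entries, and each turn of a cycle costs exactly its length. *)
Lemma realise_cycles n k (T : eqType) (C : T -> seq cperm) (l : seq T) :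
  1 < n -> 0 < k -> (forall q, q \in l -> simple_cycle n k (C q)) ->
  exists B, forall r : T -> nat, exists s, [/\ inAv n s,
    size s = B + \sum_(q <- l) r q * size (C q) &
    forall p, let X := \sum_(q <- l) r q * pcount p (C q) in
      X <= occ k p s <= B + X].
Proof.
move=> n1 k0; have n0 : 0 < n by apply: ltnW.
elim: l => [|q l IH] sim.
  exists 1 => r; exists [:: 0]; have [pd ad] := @good_decr n 1 n0 n1.
  rewrite !big_nil; split=> // p; rewrite big_nil /= addn0.
  by apply: leq_trans (count_size _ _) _; rewrite size_iota /=; lia.
have [|B HB] := IH; first by move=> q' q'l; apply: sim; rewrite inE q'l orbT.
have simq := sim q (mem_head _ _).
have [C0 [inh _]] := simq.
have [|B' HB'] := @ends_with_start n k (last (head ([::], [::]) (C q)) (C q)) n1.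
  by apply: inh; case: (C q) C0 => //= x c _; apply: mem_last.
exists (B' + B) => r; have [s [/inAv_good gs ss os]] := HB r.
have [s1 [es1 ss1 os1]] := HB' s gs.
have [s2 [es2 ss2 os2]] := ends_with_cycle (r q) n1 k0 simq es1.
exists s2; split.
- case: es2 => -[ps2 as2] _ ks _; split=> //; split=> //; lia.
- by rewrite ss2 ss1 ss big_cons; lia.
- move=> p /=; rewrite big_cons os2; have /= := os p; have := os1 p.
  by lia.
Qed.

(** * The walk of windows of a coloured permutation *)

Definition window (k : nat) (s : seq nat) (i : nat) : cperm :=
  (std (take k (drop i s)), take k (drop i (ritmo s))).

Definition walk (k : nat) (s : seq nat) : seq cperm :=
  [seq window k s i | i <- iota 0 ((size s).+1 - k)].

Lemma size_walk k s : size (walk k s) = (size s).+1 - k.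
Proof. by rewrite size_map size_iota. Qed.

Lemma occ_walk k p s : occ k p s = pcount p (walk k s).
Proof. by rewrite /pcount /walk count_map. Qed.

Lemma avoids_decr_subseq n s u : subseq u s -> avoids_decr n s -> avoids_decr n (std u).
Proof.
move=> us av t /subseqP[m _ ->]; rewrite {2}/std -map_mask.
rewrite (std_eq_oiso (oiso_map _)).
  by apply: av; apply: subseq_trans us; apply: mask_subseq.
by move=> x y /mem_mask xu /mem_mask yu; apply: std_mono.
Qed.

(* RITMO colours depend only on the entries to the left, so every window is the
   end of the coloured prefix it closes. *)
Lemma window_inherited n k s i : 1 < n -> 0 < k -> good n s -> i + k <= size s ->
  inherited n k (window k s i).
Proof.
move=> n1 k0 gs ik; have n0 : 0 < n by apply: ltnW.
have [ps _] := gs.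
have szp : size (take (i + k) s) = i + k by rewrite size_take_min; apply/minn_idPl.
have Ew : window k s i = en k (SS (std (take (i + k) s))).
  rewrite /window /en /SS /= ritmo_take // size_std szp std_drop_std.
  by rewrite size_takel ?size_ritmo // addnK !take_drop addnC.
have [pw aw] := good_take (i + k) n0 gs.
split; last first.
  exists (std (take (i + k) s)); split; last by rewrite size_std szp leq_addl.
  by split=> //; split=> //; rewrite size_std szp; lia.
split; first exact/std_permseq/take_uniq/drop_uniq/permseq_uniq.
split; last first.
  apply: avoids_decr_subseq gs.2.
  exact: subseq_trans (take_subseq _ _) (drop_subseq _ _).
by rewrite size_std size_takel // size_drop; lia.
Qed.

Lemma walk_inherited n k s e : 1 < n -> 0 < k -> good n s -> e \in walk k s ->
  inherited n k e.
Proof.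
move=> n1 k0 gs /mapP[i]; rewrite mem_iota add0n => /= ik ->.
by apply: window_inherited => //; lia.
Qed.

Lemma walk_sorted k s : 0 < k -> is_permseq s -> sorted (overlap k) (walk k s).
Proof.
case: k => // k _ ps; apply/(sortedP ([::], [::])) => i; rewrite size_walk => ik.
have H j : j < (size s).+1 - k.+1 -> nth ([::], [::]) (walk k.+1 s) j = window k.+1 s j.
  by move=> hj; rewrite (nth_map 0) ?size_iota // nth_iota.
rewrite !H //; last by apply: ltnW.
rewrite /overlap /en /be /window /= !size_std std_drop_std std_take_std.
rewrite !size_takel ?size_drop ?size_ritmo //; try lia.
have D (x : seq nat) : drop 1 (take k.+1 (drop i x)) = take k (drop i.+1 x).
  by rewrite !take_drop drop_drop add1n addSnnS.
by rewrite subSnn !take_takel // !D.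
Qed.

(** * Extraction of simple cycles *)

(** The recursion descends to the rightmost position whose image recurs later; all images after it
    are distinct, hence also those in the block up to the recurrence. *)
Lemma first_repeat (T T' : eqType) (f : T -> T') (w : seq T) : ~~ uniq (map f w) ->
  exists w1 y w2 x w3, [/\ w = w1 ++ (y :: w2) ++ x :: w3, f y = f x
    & uniq (map f (y :: w2))].
Proof.
elim: w => //= y w IH; rewrite negb_and negbK.
case: (boolP (uniq (map f w))) => [us|/IH[w1 [z [w2 [x [w3 [-> e u]]]]]] _]; last first.
  by exists (y :: w1), z, w2, x, w3.
rewrite orbF => /mapP[x xw e]; case/splitPr: xw us => w2 w3.
rewrite map_cat /= -cat_rcons cat_uniq rcons_uniq => /and3P[/andP[xn u] _ _].
by exists [::], y, w2, x, w3; rewrite /= e xn u.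
Qed.

(** Two edges with the same source, and distinct sources in between, bound a simple cycle; cutting
    it out leaves a shorter walk. The final rest has distinct sources, which bounds its length.
    Stating the count for every predicate yields both lengths and pattern counts. *)
Lemma walk_decompose n k w : sorted (overlap k) w ->
  (forall e, e \in w -> inherited n k e) ->
  exists (D : seq (seq cperm)) (r : seq cperm),
    [/\ forall C, C \in D -> simple_cycle n k C,
        uniq (map (be k.-1) r), {subset r <= w} &
        forall a : pred cperm, count a w = count a r + \sum_(C <- D) count a C].
Proof.
have [m] := ubnP (size w); elim: m w => // m IH w; rewrite ltnS => wm sw inh.
case: (boolP (uniq (map (be k.-1) w))) => [u|].
  by exists [::], w; split=> // a; rewrite big_nil addn0.
case/first_repeat => w1 [y [w2 [x [w3 [E bxy u]]]]].
have ov e : overlap k e y = overlap k e x by rewrite /overlap bxy.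
have [p1 p2 l1 l2] : [/\ sorted (overlap k) w1, path (overlap k) y w2 /\ overlap k (last y w2) x,
    path (overlap k) x w3 & w1 != [::] -> overlap k (last y w1) y].
  move: sw; rewrite E; case: w1 {E} => [|z w1] /=.
    by rewrite cat_path /= => /and3P[-> -> ->].
  by rewrite !cat_path /= cat_path /= => /andP[-> /and4P[-> -> -> ->]].
have sw' : sorted (overlap k) (w1 ++ x :: w3).
  case: w1 p1 l2 {E} => [|z w1] p1 l2 /=; first exact: l1.
  by move: p1; rewrite cat_path /= => ->; rewrite -ov l1 andbT; apply: (l2 isT).
have [D [r [sD ur rw cr]]] := IH (w1 ++ x :: w3)
  (ltac:(by apply: leq_trans wm; rewrite E !size_cat /= ltn_add2l addSn ltnS leq_addl)) sw'
  (ltac:(by move=> e ew; apply: inh; move: ew; rewrite E !mem_cat => /orP[->|->];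
            rewrite ?orbT)).
exists ((y :: w2) :: D), r; split=> //.
- move=> C; rewrite inE => /orP[/eqP ->|/sD //]; split=> //; split.
    by move=> e ew; apply: inh; rewrite E !mem_cat ew orbT.
  split; last by split=> //; apply: map_uniq u.
  by rewrite /= rcons_path; case: p2 => -> /=; rewrite -ov.
- by move=> e /rw ew; rewrite E !mem_cat; move: ew; rewrite mem_cat => /orP[->|->];
     rewrite ?orbT.
- by move=> a; rewrite big_cons addnCA -cr E !count_cat addnCA.
Qed.

(** * Finite enumeration of edges and simple cycles *)

Lemma mem_colourings k n c : size c = k -> (forall x, x \in c -> 0 < x < n) ->
  c \in colourings k n.
Proof.
elim: k c => [|k IH] [|x c] //= [sc] H; apply/allpairsP; exists (x, c); split=> //=.
  by have := H x (mem_head _ _); rewrite mem_iota; lia.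
by apply: IH => // y yc; apply: H; rewrite inE yc orbT.
Qed.

Lemma uniq_colourings k n : uniq (colourings k n).
Proof.
elim: k => //= k IH; apply: allpairs_uniq => //; first exact: iota_uniq.
by move=> [x c] [y d] _ _ /= [-> ->].
Qed.

(** A finite list containing all inherited colourings, possibly among others. *)
Definition edges (n k : nat) : seq cperm :=
  [seq (s, c) | s <- permutations (iota 0 k), c <- colourings k n].

Lemma inherited_colouring n k e : 1 < n -> inherited n k e -> e.2 \in colourings k n.
Proof.
move=> n1 [_ [s [/inAv_good gs [ks <-]]]]; have [ps _] := gs.
apply: mem_colourings; first by rewrite /= size_drop size_ritmo //; lia.
move=> x /= /mem_drop /(nthP 0)[i]; rewrite size_ritmo // => hi <-.
by apply: good_colour => //; apply: ltnW.
Qed.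

Lemma inherited_edges n k e : 1 < n -> inherited n k e -> e \in edges n k.
Proof.
move=> n1 he; apply/allpairsP; exists e; split; last by case: e {he}.
  by case: he => [[pe [se _]] _]; rewrite mem_permutations -se.
exact: inherited_colouring he.
Qed.

Fixpoint seqs_upto (T : Type) (E : seq T) (m : nat) : seq (seq T) :=
  if m is m'.+1 then [::] :: [seq e :: t | e <- E, t <- seqs_upto E m'] else [:: [::]].

Lemma mem_seqs_upto (T : eqType) (E : seq T) m t : size t <= m -> {subset t <= E} ->
  t \in seqs_upto E m.
Proof.
elim: m t => [|m IH] [|x t] //= tm H; rewrite inE; apply/orP; right.
apply/allpairsP; exists (x, t); split=> //=; first by apply: H; rewrite mem_head.
by apply: IH => // y yt; apply: H; rewrite inE yt orbT.
Qed.

(** The edges of a simple cycle are distinct, so the length bound loses none. *)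
Definition simple_cycles (n k : nat) : seq (seq cperm) :=
  undup [seq C <- seqs_upto (edges n k) (size (edges n k)) | `[< simple_cycle n k C >]].

Lemma mem_simple_cycles n k C : 1 < n ->
  (C \in simple_cycles n k) <-> simple_cycle n k C.
Proof.
move=> n1; rewrite mem_undup mem_filter; split=> [/andP[/asboolP //]|sC].
apply/andP; split; first exact/asboolP.
have [_ [inh [_ [u _]]]] := sC.
have sub : {subset C <= edges n k} by move=> e /inh /(inherited_edges n1).
exact/mem_seqs_upto/sub/uniq_leq_size.
Qed.

Lemma big_count_mem (T : eqType) (cs D : seq T) (F : T -> nat) : uniq cs ->
  {subset D <= cs} -> \sum_(C <- D) F C = \sum_(C <- cs) count_mem C D * F C.
Proof.
move=> ucs; elim: D => [|x D IH] sub.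
  by rewrite big_nil big1.
rewrite big_cons IH; last by move=> y yD; apply: sub; rewrite inE yD orbT.
under [RHS]eq_bigr => C _ do rewrite /= mulnDl.
rewrite big_split /=; congr (_ + _).
rewrite (bigD1_seq x) //=; last by apply: sub; rewrite mem_head.
rewrite eqxx mul1n big1 ?addn0 // => y yx.
by rewrite eq_sym (negbTE yx).
Qed.

Lemma pcount_colourings n k p w : (forall e, e \in w -> e.2 \in colourings k n) ->
  pcount p w = \sum_(c <- colourings k n) count_mem (p, c) w.
Proof.
elim: w => [|e w IH] H; first by rewrite big1.
rewrite /= big_split /= IH; last by move=> f fw; apply: H; rewrite inE fw orbT.
congr (_ + _).
rewrite (bigD1_seq e.2) ?uniq_colourings ?H ?mem_head //= big1 ?addn0.
  by case: e {H} => a b; rewrite xpair_eqE eqxx andbT.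
move=> c ce; case: e ce {H} => a b /= cb.
by rewrite xpair_eqE (negbTE (_ : b != c)) ?andbF // eq_sym.
Qed.

Lemma size_perm_seq k (p : 'S_k) : size (perm_seq p) = k.
Proof. by rewrite size_map size_enum_ord. Qed.

Lemma occ_cocc k (p : 'S_k) s : 0 < k ->
  count (fun i => std (take k (drop i s)) == perm_seq p) (iota 0 (size s - k).+1)
  = occ k (perm_seq p) s.
Proof.
move=> k0; rewrite /occ; case: (leqP k (size s)) => ks; first by rewrite subSn.
have -> : (size s).+1 - k = 0 by lia.
have -> : size s - k = 0 by lia.
(* The only index left in [cocc] is 0, and its window has fewer than [k] entries, so it never
   matches [perm_seq p]. *)
rewrite /= drop0 addn0; apply/eqP; rewrite eqb0; apply/eqP => /(congr1 size).
by rewrite size_std size_perm_seq take_oversize; lia.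
Qed.

Import Order.TTheory GRing.Theory Num.Theory.
Import numFieldNormedType.Exports.
Local Open Scope classical_set_scope.
Local Open Scope ring_scope.

(** * The projected polytope and limits *)

Section Analysis.
Variable R : realType.

Definition freq k (p : 'S_k) (C : seq cperm) : R :=
  (pcount (perm_seq p) C)%:R / (size C)%:R.

Lemma Pi_ecyc n k C (p : 'S_k) : (1 < n)%N -> simple_cycle n k C ->
  Pi R n k (ecyc R C) p = freq p C.
Proof.
move=> n1 [_ [inh _]]; rewrite /Pi /ecyc /freq -mulr_suml; congr (_ / _).
rewrite (@pcount_colourings n k); first by rewrite natr_sum.
by move=> e /inh; apply: inherited_colouring.
Qed.

(** By linearity the projection of the hull is the hull of the projected cycle vectors, whose
    coordinates are given by [freq]. *)
Lemma Pi_cycle_polytopeE n k (v : 'S_k -> R) : (1 < n)%N ->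
  Pi_cycle_polytope R n k v <-> exists l : seq (R * seq cperm),
    [/\ forall q, q \in l -> 0 <= q.1 /\ simple_cycle n k q.2,
        \sum_(q <- l) q.1 = 1 &
        forall p, v p = \sum_(q <- l) q.1 * freq p q.2].
Proof.
move=> n1.
have E l (p : 'S_k) : (forall q, q \in l -> 0 <= q.1 /\ simple_cycle n k q.2) ->
    Pi R n k (fun e => \sum_(q <- l) q.1 * ecyc R q.2 e) p
    = \sum_(q <- l) q.1 * freq p q.2.
  move=> H; rewrite /Pi exchange_big /=; apply: eq_big_seq => q /H[_ sq].
  by rewrite -mulr_sumr -/(Pi R n k _ p) (Pi_ecyc p n1 sq).
split=> [[x [[l [H [l1 xl]]] vx]]|[l [H l1 vl]]].
  exists l; split=> // p; rewrite vx -E // /Pi.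
  by apply: eq_bigr => c _; rewrite xl.
exists (fun e => \sum_(q <- l) q.1 * ecyc R q.2 e); split.
  by exists l.
by move=> p; rewrite vl E.
Qed.

Lemma cocc_occ k (p : 'S_k) s : (0 < k)%N ->
  cocc R p s = (occ k (perm_seq p) s)%:R / (size s)%:R.
Proof. by move=> k0; rewrite /cocc occ_cocc. Qed.

Lemma cvg_ratio (a b : nat -> R) (v K : R) :
  (forall j, `|a j - v * b j| <= K) -> (forall j, 0 < b j) ->
  (forall M : nat, exists N, forall j, (N <= j)%N -> M%:R <= b j) ->
  (fun j => a j / b j) @ \oo --> v.
Proof.
move=> H b0 binf; apply/cvgrPdist_le => e e0.
have K0 : 0 <= K by apply: le_trans (H 0%N).
have [N HN] := binf (Num.truncn (K / e)).+1.
exists N => // j /= /HN bj.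
have Ke : K / e <= b j.
  by apply: le_trans bj; apply/ltW; rewrite truncnS_gt.
have -> : v - a j / b j = - ((a j - v * b j) / b j).
  by field; rewrite gt_eqF.
rewrite normrN normrM normfV (gtr0_norm (b0 j)) ler_pdivrMr //.
by apply: le_trans (H j) _; rewrite mulrC -ler_pdivrMr.
Qed.

Lemma continuous_sum (U : topologicalType) (I : finType) (g : I -> U -> R) :
  (forall i, continuous (g i)) -> continuous (fun x => \sum_i g i x).
Proof.
move=> cg; apply: (@continuous_big _ _ _ _ predT) => // x.
exact: add_continuous.
Qed.

Lemma continuous_defect (U : topologicalType) (I T : finType) (g : I -> U -> R)
    (f : I -> T -> R) (v : T -> R) : (forall i, continuous (g i)) ->
  continuous (fun x => `|1 - \sum_i g i x| + \sum_p `|v p - \sum_i g i x * f i p|).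
Proof.
move=> cg x; apply: cvgD.
  apply: cvg_norm; apply: cvgB; first exact: cvg_cst.
  exact: continuous_sum.
apply: continuous_sum => p y; apply: cvg_norm; apply: cvgB; first exact: cvg_cst.
apply: continuous_sum => i z; apply: cvgM; [exact: cg|exact: cvg_cst].
Qed.

(** Compactness: the defect [G] attains its minimum on the cube, and arbitrarily good approximations
    force this minimum to vanish, so both of its terms are zero there. *)
Lemma hull_closed (N : nat) (T : finType) (f : 'I_N -> T -> R) (v : T -> R) :
  (forall e, 0 < e -> exists a : 'I_N -> R, [/\ forall i, 0 <= a i, \sum_i a i = 1 &
     forall p, `|v p - \sum_i a i * f i p| <= e]) ->
  exists a : 'I_N -> R, [/\ forall i, 0 <= a i, \sum_i a i = 1 &
     forall p, v p = \sum_i a i * f i p].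
Proof.
move=> H.
(* The first term of [G] penalises coefficients outside the simplex, so that
   it can be minimised over the compact cube. *)
pose G (a : 'rV[R]_N) : R :=
  `|1 - \sum_i a ord0 i| + \sum_p `|v p - \sum_i a ord0 i * f i p|.
pose A : set 'rV[R]_N := [set a | forall i, a ord0 i \in `[0, 1]].
have cA : compact A.
  apply: (@rV_compact _ _ (fun=> `[(0 : R), 1]%classic)) => i.
  exact: segment_compact.
have cG : continuous G.
  by apply: continuous_defect => i; apply: coord_continuous.
have inA (a : 'I_N -> R) : (forall i, 0 <= a i) -> \sum_i a i = 1 -> A (\row_i a i).
  move=> a0 a1 i; rewrite /= in_itv /= mxE a0 /= -a1 (bigD1 i) //= lerDl.
  exact: sumr_ge0.
have A0 : A !=set0.
  by have [a [a0 a1 _]] := H 1 ltr01; exists (\row_i a i); apply: inA.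
have [c cinA cmin] := compact_EVT_min A0 cA (continuous_subspaceT cG).
have Gc0 : G c <= 0.
  apply/ler_addgt0Pl => e e0; rewrite addr0.
  (* Summed over [T] this error is at most [e]; the successor keeps the denominator nonzero for
     empty [T]. *)
  have d0 : 0 < e / (#|T|.+1)%:R by rewrite divr_gt0.
  have [a [a0 a1 ap]] := H _ d0.
  apply: le_trans (cmin (\row_i a i) _) _; first by rewrite inE; apply: inA.
  rewrite /G; under eq_bigr => i _ do rewrite mxE.
  rewrite a1 subrr normr0 add0r.
  apply: (@le_trans _ _ (\sum_(p : T) e / (#|T|.+1)%:R)).
    apply: ler_sum => p _; apply: le_trans (ap p).
    by under eq_bigr => i _ do rewrite mxE.
  rewrite sumr_const -[leLHS]mulr_natr -mulrA ler_piMr ?(ltW e0) //.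
  by rewrite mulrC ler_pdivrMr // mul1r ler_nat leqW // max_card.
have S0 : 0 <= \sum_p `|v p - \sum_i c ord0 i * f i p| by apply: sumr_ge0.
exists (fun i => c ord0 i); split.
- by move=> i; move: cinA; rewrite inE => /(_ i); rewrite /= in_itv /= => /andP[].
- apply/eqP; rewrite eq_sym -subr_eq0 -normr_le0.
  by apply: le_trans Gc0; rewrite /G lerDl.
- move=> p; apply/eqP; rewrite -subr_eq0 -normr_le0; apply: le_trans Gc0.
  rewrite /G (bigD1 p) //= addrCA lerDl addr_ge0 //; exact: sumr_ge0.
Qed.

Lemma cocc_approx n k : (1 < n)%N -> (0 < k)%N ->
  exists K : nat, forall s, inAv n s -> (K < size s)%N ->
    exists a : seq cperm -> R,
      [/\ forall C, 0 <= a C, \sum_(C <- simple_cycles n k) a C = 1 &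
          forall p : 'S_k, `|cocc R p s - \sum_(C <- simple_cycles n k) a C * freq p C|
            <= K%:R / (size s)%:R].
Proof.
move=> n1 k0; pose E := size (edges n k).
(* [E] bounds the rest of the walk, and [k] covers the [k.-1] entries by which [size s] exceeds the
   number of windows. *)
exists (E + k)%N => s /inAv_good gs ms.
have inh e : e \in walk k s -> inherited n k e by apply: walk_inherited.
have [D [r [sD ur rw cr]]] := walk_decompose (walk_sorted k0 gs.1) inh.
have rE : (size r <= E)%N.
  rewrite -(size_map (be k.-1)) /E -[X in (_ <= X)%N](size_map (be k.-1)).
  apply: uniq_leq_size => // e /mapP[f /rw /inh fi ->].
  by apply: map_f; apply: inherited_edges.
pose L := (\sum_(C <- D) size C)%N.
have sizes : ((size s).+1 - k = size r + L)%N.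
  under [L]eq_bigr => C _ do rewrite -count_predT.
  by rewrite -size_walk -(count_predT (walk k s)) cr count_predT; congr addn.
have L0 : (0 < L)%N by lia.
have L0' : 0 < L%:R :> R by rewrite ltr0n.
have subD : {subset D <= simple_cycles n k}.
  by move=> C /sD /(mem_simple_cycles _ _ n1).
have ucs : uniq (simple_cycles n k) by apply: undup_uniq.
(* The weight of [C] is the share of its copies among all edges lying in extracted cycles. *)
exists (fun C => (count_mem C D * size C)%N%:R / L%:R); split.
- by move=> C; rewrite divr_ge0.
- rewrite -mulr_suml -natr_sum.
  by rewrite -(@big_count_mem _ _ D) // divff // gt_eqF.
move=> p; rewrite cocc_occ //.
have sC C : C \in simple_cycles n k -> size C != 0%N.
  by move=> /(mem_simple_cycles _ _ n1)[+ _]; rewrite size_eq0.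
set X := (\sum_(C <- D) pcount (perm_seq p) C)%N.
have -> : \sum_(C <- simple_cycles n k)
    (count_mem C D * size C)%N%:R / L%:R * freq p C = X%:R / L%:R.
  rewrite /X (big_count_mem _ ucs subD) natr_sum mulr_suml.
  apply: eq_big_seq => C /sC nz; rewrite /freq !natrM.
  by field; rewrite !pnatr_eq0 nz -lt0n L0.
have XL : (X <= L)%N by apply: leq_sum => C _; apply: count_size.
have occE : occ k (perm_seq p) s = (pcount (perm_seq p) r + X)%N.
  by rewrite occ_walk /pcount cr.
have pr : (pcount (perm_seq p) r <= size r)%N by apply: count_size.
have m0 : 0 < (size s)%:R :> R by rewrite ltr0n; lia.
have mE : (size s)%:R = L%:R + (size r + k.-1)%N%:R :> R.
  by rewrite -natrD; congr (_%:R); lia.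
rewrite occE natrD.
set y := X%:R / L%:R; have XE : X%:R = y * L%:R :> R by rewrite /y divfK // gt_eqF.
(* Since [size s] is [L] plus [size r + k.-1], the error is a difference of two numbers between 0
   and [E + k], divided by [size s]. *)
have -> : (((pcount (perm_seq p) r)%:R + X%:R) / (size s)%:R - y : R) =
    ((pcount (perm_seq p) r)%:R - y * (size r + k.-1)%N%:R) / (size s)%:R.
  apply: (mulIf (lt0r_neq0 m0)); rewrite mulrBl !divfK ?gt_eqF // XE mE; ring.
rewrite normrM normfV (gtr0_norm m0) ler_pM2r ?invr_gt0 //.
have y0 : 0 <= y by rewrite divr_ge0.
have y1 : y <= 1 by rewrite ler_pdivrMr // mul1r ler_nat.
have c0 : 0 <= (size r + k.-1)%N%:R :> R by [].
have b1 : (pcount (perm_seq p) r)%:R <= (E + k)%N%:R :> R by rewrite ler_nat; lia.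
have b2 : (size r + k.-1)%N%:R <= (E + k)%N%:R :> R by rewrite ler_nat; lia.
have b3 : 0 <= (pcount (perm_seq p) r)%:R :> R by [].
have b4 : y * (size r + k.-1)%N%:R <= (size r + k.-1)%N%:R by apply: ler_piMl.
have b5 : 0 <= y * (size r + k.-1)%N%:R by apply: mulr_ge0.
by rewrite ler_norml; apply/andP; split; lra.
Qed.

(** * The two inclusions *)

Lemma PAv_sub n k (v : 'S_k -> R) : (1 < n)%N -> (0 < k)%N ->
  PAv R n k v -> Pi_cycle_polytope R n k v.
Proof.
move=> n1 k0 [s [sAv [sinf scvg]]].
have [K HK] := cocc_approx n1 k0.
pose cs := simple_cycles n k.
pose t (i : 'I_(size cs)) := tnth (in_tuple cs) i.
have [|a [a0 a1 av]] := @hull_closed (size cs) _ (fun i p => freq p (t i)) v.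
  move=> e e0; have e2 : 0 < e / 2 by rewrite divr_gt0.
  have near p : \forall j \near \oo, `|v p - cocc R p (s j)| <= e / 2.
    by have /cvgrPdist_le := scvg p; apply.
  have /filter_forall [N _ HN] := near.
  (* The first bound lets [cocc_approx] apply, the second makes its error at most [e / 2]. *)
  have [M HM] := sinf (maxn K.+1 (Num.truncn (K%:R / (e / 2))).+1).
  pose j := maxn N M.
  have := HM j (leq_maxr _ _); rewrite geq_max => /andP[Ks Es].
  have [a [a0 a1 ap]] := HK (s j) (sAv j) Ks.
  exists (fun i => a (t i)); split=> [i|| p]; first exact: a0.
    by move: a1; rewrite big_tnth.
  have := ap p; rewrite big_tnth -/cs -/t => ap'.
  have := HN j (leq_maxl _ _) p => /= hv.
  have m0 : 0 < (size (s j))%:R :> R by rewrite ltr0n; lia.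
  have Ke : K%:R / (size (s j))%:R <= e / 2.
    rewrite ler_pdivrMr // mulrC -ler_pdivrMr //.
    apply: le_trans (_ : _ <= (Num.truncn (K%:R / (e / 2))).+1%:R) _; last first.
      by rewrite ler_nat.
    by apply/ltW; rewrite truncnS_gt.
  apply: le_trans (ler_distD (cocc R p (s j)) _ _) _.
  have -> : e = e / 2 + e / 2 by field.
  by apply: lerD => //; apply: le_trans ap' Ke.
apply/(Pi_cycle_polytopeE _ n1).
exists [seq (a i, t i) | i <- enum 'I_(size cs)]; split.
- move=> q /mapP[i _ ->]; split; first exact: a0.
  by apply/(mem_simple_cycles _ _ n1); apply: mem_tnth.
- by rewrite big_map big_enum.
- by move=> p; rewrite av big_map big_enum.
Qed.

Lemma PAv_sup n k (v : 'S_k -> R) : (1 < n)%N -> (0 < k)%N ->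
  Pi_cycle_polytope R n k v -> PAv R n k v.
Proof.
move=> n1 k0 /(Pi_cycle_polytopeE _ n1)[l [lP l1 lv]].
have [|B HB] := @realise_cycles n k _ (fun q : R * seq cperm => q.2) l n1 k0.
  by move=> q /lP[].
(* This many turns of the cycle [q.2] produce [q.1 * j] entries, hence about [j] in all; [rn] rounds
   down. *)
pose rr (j : nat) (q : R * seq cperm) : R := q.1 * j%:R / (size q.2)%:R.
pose rn j q := Num.truncn (rr j q).
have [s sP] := choice (fun j => HB (rn j)).
pose S := (\sum_(q <- l) size q.2)%N.
have size0 q : q \in l -> 0 < (size q.2)%:R :> R.
  by move=> /lP[_ [+ _]]; rewrite ltr0n lt0n size_eq0.
have rnP j q : q \in l -> 0 <= rr j q - (rn j q)%:R <= 1.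
  move=> ql; have rr0 : 0 <= rr j q.
    by rewrite divr_ge0 // mulr_ge0 //; case: (lP q ql).
  have := truncn_itv rr0; rewrite -/(rn j q) -natr1 => /andP[h1 h2].
  by apply/andP; split; lra.
(* Rounding loses at most one turn per cycle, hence at most [S] in any count bounded by the cycle
   lengths; this serves for sizes and for pattern counts. *)
have err j (c : R * seq cperm -> nat) : (forall q, q \in l -> (c q <= size q.2)%N) ->
    0 <= \sum_(q <- l) rr j q * (c q)%:R - (\sum_(q <- l) rn j q * c q)%N%:R <= S%:R.
  move=> cS; rewrite natr_sum -sumrB /S natr_sum; apply/andP; split.
    rewrite big_seq sumr_ge0 // => q ql; rewrite natrM -mulrBl mulr_ge0 //.
    by case/andP: (rnP j q ql).
  rewrite [leLHS]big_seq [leRHS]big_seq; apply: ler_sum => q ql.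
  rewrite natrM -mulrBl; have /andP[h1 h2] := rnP j q ql.
  apply: le_trans (_ : _ <= (c q)%:R) _; last by rewrite ler_nat cS.
  exact: ler_piMl.
have sz j : `|(size (s j))%:R - j%:R| <= (B + S)%N%:R :> R.
  have [_ -> _] := sP j.
  have := err j (fun q => size q.2) (fun _ _ => leqnn _).
  have -> : \sum_(q <- l) rr j q * (size q.2)%:R = j%:R.
    transitivity (\sum_(q <- l) q.1 * j%:R); last by rewrite -mulr_suml l1 mul1r.
    apply: eq_big_seq => q ql.
    by rewrite /rr divfK // gt_eqF ?size0.
  have B0 : 0 <= B%:R :> R by [].
  by rewrite !natrD ler_norml => /andP[h1 h2]; apply/andP; split; lra.
have oc j p : `|(occ k (perm_seq p) (s j))%:R - v p * j%:R| <= (B + S)%N%:R :> R.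
  have [_ _ /(_ (perm_seq p)) /= /andP[u1 u2]] := sP j.
  have := err j (fun q => pcount (perm_seq p) q.2) (fun _ _ => count_size _ _).
  have -> : \sum_(q <- l) rr j q * (pcount (perm_seq p) q.2)%:R = v p * j%:R.
    rewrite lv mulr_suml; apply: eq_bigr => q _; rewrite /rr /freq.
    by rewrite mulrAC -!mulrA; congr (_ * _); rewrite mulrC mulrA mulrAC mulrC.
  move: u1 u2; rewrite -!(ler_nat R) !natrD => u1 u2.
  by rewrite ler_norml => /andP[h1 h2]; apply/andP; split; lra.
exists s; split; first by move=> j; case: (sP j).
have sinf M : exists N, forall j, (N <= j)%N -> (M <= size (s j))%N.
  exists (M + (B + S))%N => j hj; rewrite -(ler_nat R).
  have := sz j; rewrite ler_norml => /andP[h1 _].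
  by move: hj; rewrite -(ler_nat R) natrD; lra.
split=> // p.
have E : (fun j => cocc R p (s j)) =
    (fun j => (occ k (perm_seq p) (s j))%:R / (size (s j))%:R).
  by apply/funext => j; rewrite cocc_occ.
(* The constant comes from splitting [occ - v * size] as [(occ - v * j) + v * (j - size)] and
   bounding the parts by [oc] and [sz]. *)
rewrite E; apply: (@cvg_ratio _ _ _ ((B + S)%N%:R + `|v p| * (B + S)%N%:R)).
- move=> j; rewrite -(subrK (v p * j%:R) (occ _ _ _)%:R) -addrA -mulrBr.
  apply: le_trans (ler_normD _ _) (lerD (oc j p) _).
  by rewrite normrM distrC ler_wpM2l.
- by move=> j; rewrite ltr0n; case: (sP j) => -[_ []].
- by move=> M; have [N HN] := sinf M; exists N => j /HN; rewrite ler_nat.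
Qed.

End Analysis.

Theorem mainTheorem7 (R : realType) (n k : nat) :
  (2 <= n)%N -> (1 <= k)%N ->
  forall v : 'S_k -> R, PAv R n k v <-> Pi_cycle_polytope R n k v.
Proof. by move=> n2 k1 v; split; [exact: PAv_sub|exact: PAv_sup]. Qed.
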